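(* Let $\mathcal{G}$ be a finite groupoid with $k=|\mathcal{G}_0|$ identities and connected components $\mathcal{G}_j$, $1\le j\le t$, let $e_j\in(\mathcal{G}_j)_0$ for each $j$, and let $\mathcal{H}$ be a subgroupoid of $\mathcal{G}$. The following statements hold. (i) The order of $\mathcal{H}$ is of the form $$|\mathcal{H}|=\sum_{j=1}^{\ell}d_j^2m_j,$$ where $\ell$ is the number of connected components of $\mathcal{H}$, $\sum_j d_j\le k$, and each $m_j$ divides $|\mathcal{G}_{e_s}|$, where $s$ is the index of the connected component $\mathcal{G}_s$ of $\mathcal{G}$ that contains the $j$-th connected component of $\mathcal{H}$. (ii) If $\mathcal{G}$ and $\mathcal{H}$ are connected and $|\mathcal{H}_0|$ divides $|\mathcal{G}_0|$, then $|\mathcal{H}|$ divides $|\mathcal{G}|$. (iii) If $\mathcal{G}_{e_j}$ is the isotropy group of $\mathcal{G}_j$, $\mathcal{H}$ is wide with connected components $\mathcal{K}_i$ and, for $f_i\in(\mathcal{K}_i)_0$, $\mathcal{K}_{f_i}$ is the isotropy group of $\mathcal{K}_i$, for $1\le i\le n$, and $\mathcal{H}_j=\mathcal{G}_j\cap\mathcal{H}$, then $$|\mathcal{G}|=\sum_{j=1}^{t}|(\mathcal{G}_j)_0|\left(\sum_{i=1}^{n}(\mathcal{G}_{e_j}:\mathcal{K}_{f_i})\,|(\mathcal{H}_j)_0|\,|\mathcal{K}_{f_i}|\right).$$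
   Context: A groupoid is a nonempty set $\mathcal{G}$ with a partially defined associative operation in which every $g$ has an inverse $g^{-1}$, a right identity $d(g)=g^{-1}g$ (domain) and a left identity $r(g)=gg^{-1}$ (range); the product $gh$ exists if and only if $d(g)=r(h)$. $\mathcal{G}_0$ denotes its set of identities, and for $e\in\mathcal{G}_0$ the isotropy group at $e$ is $\mathcal{G}_e=\{g\in\mathcal{G}:d(g)=r(g)=e\}$. A subgroupoid is a nonempty subset $\mathcal{H}$ which is a groupoid under the restricted operation; it is wide if $\mathcal{H}_0=\mathcal{G}_0$. A groupoid is connected if for any identities $e,f$ there is $g$ with $d(g)=e$ and $r(g)=f$; in a connected groupoid all isotropy groups are isomorphic. Every groupoid is the disjoint union of its connected components (the maximal connected subgroupoids). $|\cdot|$ is cardinality. $(A:B)$ denotes the index of a group $B$ in a group $A$, i.e. $|A|/|B|$ for finite groups; in the formula of (iii) this notation is used also when the two isotropy groups are taken at different identities.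
   Formalization: In (iii) the printed formula is false unless n=1 (its right side equals n|G|; e.g. G=H two identities gives 2=4), so the factor |(H_j)_0| in the i-th summand is replaced by |(H_j ∩ K_i)_0|, the number of identities of H_j lying in K_i. *)

(* Defs.v *)
From mathcomp Require Import all_boot all_order all_algebra.

Set Implicit Arguments.
Unset Strict Implicit.
Unset Printing Implicit Defensive.

(* [op g h = None] means that the product gh does not exist.
   The axioms are relative to a subset A of the carrier, so that a subset of a
   groupoid can be asked to be a groupoid for the restriction of [op] to it.
   Equality of options in [gpd_assoc] says that g(hl) exists iff (gh)l does, and
   that they are then equal. *)
Record groupoid_on (T : finType) (op : T -> T -> option T) (inv d r : T -> T)
    (A : {set T}) : Prop := GroupoidOn {
  gpd_nonempty : A != set0;
  gpd_closed : forall g h x, g \in A -> h \in A -> op g h = Some x -> x \in A;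
  gpd_inv_closed : forall g, g \in A -> inv g \in A;
  gpd_assoc : forall g h l, g \in A -> h \in A -> l \in A ->
    obind (fun x => op g x) (op h l) = obind (fun x => op x l) (op g h);
  gpd_dom : forall g, g \in A -> op (inv g) g = Some (d g);
  gpd_rng : forall g, g \in A -> op g (inv g) = Some (r g);
  gpd_domr : forall g, g \in A -> op g (d g) = Some g;
  gpd_rngl : forall g, g \in A -> op (r g) g = Some g;
  gpd_defined : forall g h, g \in A -> h \in A -> isSome (op g h) = (d g == r h)
}.

Structure finGroupoid := FinGroupoid {
  gsort :> finType;
  gop : gsort -> gsort -> option gsort;
  ginv : gsort -> gsort;
  gdom : gsort -> gsort;
  grng : gsort -> gsort;
  gpdP : groupoid_on gop ginv gdom grng [set: gsort]
}.

Definition subgroupoid (G : finGroupoid) (H : {set G}) : Prop :=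
  exists inv d r : G -> G, groupoid_on (@gop G) inv d r H.

Definition idents (G : finGroupoid) (A : {set G}) : {set G} :=
  [set gdom g | g in A] :|: [set grng g | g in A].

Definition isotropy (G : finGroupoid) (A : {set G}) (e : G) : {set G} :=
  [set g in A | (gdom g == e) && (grng g == e)].

Definition gconnected (G : finGroupoid) (A : {set G}) : Prop :=
  forall e f, e \in idents A -> f \in idents A ->
    exists2 g, g \in A & gdom g = e /\ grng g = f.

Definition wide (G : finGroupoid) (H : {set G}) : Prop :=
  idents H = idents [set: G].

Definition component (G : finGroupoid) (A C : {set G}) : Prop :=
  [/\ subgroupoid C, C \subset A, gconnected C
    & forall D : {set G}, subgroupoid D -> D \subset A -> gconnected D ->
        C \subset D -> D = C].

(* F lists the connected components of A, each exactly once. *)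
Definition components_of (G : finGroupoid) (A : {set G}) (n : nat)
    (F : 'I_n -> {set G}) : Prop :=
  injective F /\ forall C, component A C <-> exists j, F j = C.

(* (A : B) = |A| / |B| as a rational number: it is also used when B is not a
   subset of A, so it need not be an integer. *)
Definition index_ratio (T : finType) (A B : {set T}) : rat :=
  (#|A|%:R / #|B|%:R)%R.

(* Facts connecting [subgroupoid], whose inverses and identities are a priori
   its own, with the operations of the ambient groupoid. *)
Lemma gop_cancel (G : finGroupoid) (g x y z : G) :
  gop g x = Some z -> gop g y = Some z -> x = y.
Proof.
have [_ _ _ A D _ _ RL df] := gpdP G.
have K u : gop g u = Some z -> gop (ginv g) z = Some u.
  move=> E; have := A (ginv g) g u (in_setT _) (in_setT _) (in_setT _).
  rewrite E D ?inE //= => ->.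
  have /eqP -> : gdom g == grng u by rewrite -df ?inE // E.
  by rewrite RL ?inE.
by move=> /K E1 /K; rewrite E1 => -[].
Qed.

Lemma groupoid_on_ops (G : finGroupoid) (H : {set G}) inv d r :
  groupoid_on (@gop G) inv d r H ->
  forall g, g \in H -> [/\ inv g = ginv g, d g = gdom g & r g = grng g].
Proof.
have [_ _ _ A D R DR RL df] := gpdP G.
move=> [_ _ Hi _ D' R' DR' RL' _] g gH.
have Ed : d g = gdom g by apply: gop_cancel (DR' g gH) (DR g (in_setT _)).
have Er : r g = grng g.
  have E : gop (r g) (r g) = Some (r g).
    have := A (r g) g (inv g) (in_setT _) (in_setT _) (in_setT _).
    by rewrite R' // RL' //= R'.
  have drr : gdom (r g) = r g.
    by apply: gop_cancel (DR (r g) (in_setT _)) E.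
  have : gdom (r g) == grng g by rewrite -df ?inE // RL'.
  by rewrite drr => /eqP.
by split=> //; apply: (@gop_cancel G g); rewrite ?R ?R' ?Er ?inE.
Qed.

Lemma subgroupoidP (G : finGroupoid) (H : {set G}) :
  subgroupoid H <->
  [/\ H != set0,
      forall g h x, g \in H -> h \in H -> gop g h = Some x -> x \in H
    & forall g, g \in H -> ginv g \in H].
Proof.
split=> [[inv [d [r HH]]] | [H0 Hc Hi]].
  have ops := groupoid_on_ops HH; case: HH => H0 Hc Hi _ _ _ _ _ _.
  by split=> // g gH; have [<- _ _] := ops g gH; apply: Hi.
have [_ _ _ A D R DR RL df] := gpdP G.
exists (@ginv G), (@gdom G), (@grng G).
by split=> // *; rewrite ?A ?D ?R ?DR ?RL ?df ?inE.
Qed.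

(* Main.v *)
Require Import Defs.
From mathcomp Require Import all_boot all_order all_algebra.

(** A connected groupoid [C] looks the same everywhere: translating on the left
    and on the right by elements of [C] identifies any two of its sets of
    elements with prescribed domain and range. There are [#|idents C| ^ 2] such
    sets, and one of them is the isotropy group at a given identity [f], whence
    [#|C| = #|idents C| ^ 2 * #|isotropy C f|] ([card_gconnected]). A
    subgroupoid is the disjoint union of its components ([sum_card_components]),
    so this formula computes the order of any subgroupoid. The three statements
    follow.

    (i) Take for [d j] and [m j] the number of identities and the order of an
    isotropy group of the [j]-th component. The components share out the
    identities of [H], which are identities of [G]. The isotropy group of a
    component of [H] at [x] is a subgroup of the isotropy group of [G] at [x]
    (Lagrange's theorem, [dvdn_isotropy]), which has the order of the isotropy
    group of [G] at any identity connected to [x].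

    (ii) Both factors of [#|H|] divide the corresponding factor of [#|G|], the
    second one by Lagrange's theorem again.

    (iii) The orders of the isotropy groups of the components of [H] cancel, and
    the inner sum becomes [#|isotropy (Gc j) (e j)|] times the number of
    identities of [Gc j] counted along the components of [H]. As [H] is wide
    this number is [#|idents (Gc j)|], and the formula reduces to
    [card_gconnected] for each component of [G]. *)

Section Groupoid.

Set Implicit Arguments.
Unset Strict Implicit.
Unset Printing Implicit Defensive.

Variable G : finGroupoid.
Implicit Types (g h l x y : G) (A B C D : {set G}).

(** * Calculus in a groupoid *)

(** A total product, which allows composable elements to be multiplied and
    cancelled by rewriting; on other pairs its value is a default one. *)
Definition gmul g h : G := odflt g (gop g h).

Lemma gopE g h : gdom g = grng h -> gop g h = Some (gmul g h).
Proof.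
have [_ _ _ _ _ _ _ _ df] := gpdP G.
move=> E; have := df g h (in_setT g) (in_setT h).
by rewrite E eqxx /gmul; case: gop.
Qed.

Lemma gop_composable g h x : gop g h = Some x -> gdom g = grng h.
Proof.
have [_ _ _ _ _ _ _ _ df] := gpdP G.
by move=> E; apply/eqP; rewrite -df ?inE // E.
Qed.

Lemma gop_gmul g h x : gop g h = Some x -> gmul g h = x.
Proof. by rewrite /gmul => ->. Qed.

Lemma gmulVg g : gmul (ginv g) g = gdom g.
Proof. by apply: gop_gmul; apply: (gpd_dom (gpdP G)); rewrite inE. Qed.

Lemma gmulgV g : gmul g (ginv g) = grng g.
Proof. by apply: gop_gmul; apply: (gpd_rng (gpdP G)); rewrite inE. Qed.

Lemma gmul_gdom g : gmul g (gdom g) = g.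
Proof. by apply: gop_gmul; apply: (gpd_domr (gpdP G)); rewrite inE. Qed.

Lemma gmul_grng g : gmul (grng g) g = g.
Proof. by apply: gop_gmul; apply: (gpd_rngl (gpdP G)); rewrite inE. Qed.

Lemma gdomV g : gdom (ginv g) = grng g.
Proof. exact: gop_composable (gpd_dom (gpdP G) (in_setT g)). Qed.

Lemma grngV g : grng (ginv g) = gdom g.
Proof. by rewrite (gop_composable (gpd_rng (gpdP G) (in_setT g))). Qed.

Lemma grng_gdom g : grng (gdom g) = gdom g.
Proof. by rewrite -(gop_composable (gpd_domr (gpdP G) (in_setT g))). Qed.

Lemma gdom_grng g : gdom (grng g) = grng g.
Proof. exact: gop_composable (gpd_rngl (gpdP G) (in_setT g)). Qed.

Lemma gdom_gdom g : gdom (gdom g) = gdom g.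
Proof. by have := gdom_grng (gdom g); rewrite grng_gdom. Qed.

Lemma grng_ident x : gdom x = x -> grng x = x.
Proof. by move=> <-; apply: grng_gdom. Qed.

(** Definedness of a product is read off from domains and ranges, so the domain
    of [gh] is known once [(gh) d(h)] is seen to exist, which is associativity
    applied to [g (h d(h))]. *)
Lemma gdomM g h : gdom g = grng h -> gdom (gmul g h) = gdom h.
Proof.
move=> E; have := gpd_assoc (gpdP G) (in_setT g) (in_setT h) (in_setT (gdom h)).
rewrite (gpd_domr (gpdP G) (in_setT h)) /= (gopE E) /=.
by move/esym/gop_composable; rewrite grng_gdom.
Qed.

Lemma grngM g h : gdom g = grng h -> grng (gmul g h) = grng g.
Proof.
move=> E; have := gpd_assoc (gpdP G) (in_setT (grng g)) (in_setT g) (in_setT h).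
rewrite (gpd_rngl (gpdP G) (in_setT g)) /= (gopE E) /=.
by move=> /gop_composable <-; rewrite gdom_grng.
Qed.

Lemma gmulA g h l : gdom g = grng h -> gdom h = grng l ->
  gmul g (gmul h l) = gmul (gmul g h) l.
Proof.
move=> E F; have := gpd_assoc (gpdP G) (in_setT g) (in_setT h) (in_setT l).
by rewrite (gopE E) (gopE F) /= !gopE ?gdomM ?grngM // => -[].
Qed.

Lemma gmulK g h : gdom g = grng h -> gmul (gmul g h) (ginv h) = g.
Proof. by move=> E; rewrite -gmulA ?grngV // gmulgV -E gmul_gdom. Qed.

Lemma gmulKg g h : gdom g = grng h -> gmul (ginv g) (gmul g h) = h.
Proof. by move=> E; rewrite gmulA ?gdomV // gmulVg E gmul_grng. Qed.

Lemma gmulKVg g h : grng h = grng g -> gmul g (gmul (ginv g) h) = h.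
Proof. by move=> E; rewrite gmulA ?gdomV ?grngV // gmulgV -E gmul_grng. Qed.

(** * Subgroupoids and their identities *)

Lemma subgroupoid_gmul A g h : subgroupoid A ->
  g \in A -> h \in A -> gdom g = grng h -> gmul g h \in A.
Proof. by case/subgroupoidP=> _ M _ gA hA /gopE; apply: M. Qed.

Lemma subgroupoid_ginv A g : subgroupoid A -> g \in A -> ginv g \in A.
Proof. by case/subgroupoidP=> _ _; apply. Qed.

Lemma subgroupoid_gdom A g : subgroupoid A -> g \in A -> gdom g \in A.
Proof.
move=> sA gA; rewrite -gmulVg subgroupoid_gmul ?subgroupoid_ginv //.
exact: gdomV.
Qed.

Lemma subgroupoid_grng A g : subgroupoid A -> g \in A -> grng g \in A.
Proof.
by move=> sA gA; rewrite -gdomV subgroupoid_gdom // subgroupoid_ginv.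
Qed.

Lemma subgroupoidT : subgroupoid [set: G].
Proof. by exists (@ginv G), (@gdom G), (@grng G); apply: gpdP. Qed.

Lemma subgroupoid_nonempty A : subgroupoid A -> exists g, g \in A.
Proof. by case/subgroupoidP=> /set0Pn. Qed.

(** Stated for any set closed under domains and ranges, so as to apply to an
    intersection of subgroupoids, which may be empty. *)
Lemma mem_idents A x :
    (forall g, g \in A -> gdom g \in A) -> (forall g, g \in A -> grng g \in A) ->
  (x \in idents A) = (x \in A) && (gdom x == x).
Proof.
move=> dA rA; apply/setUP/andP=> [|[xA /eqP Dx]].
  case=> /imsetP[g gA ->]; first by rewrite dA ?gdom_gdom.
  by rewrite rA ?gdom_grng.
by left; apply/imsetP; exists x.
Qed.

Lemma mem_subgroupoid_idents A x :
  subgroupoid A -> (x \in idents A) = (x \in A) && (gdom x == x).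
Proof.
move=> sA; apply: mem_idents => g; first exact: subgroupoid_gdom.
exact: subgroupoid_grng.
Qed.

Lemma identsP A x : subgroupoid A -> x \in idents A -> x \in A /\ gdom x = x.
Proof. by move=> sA; rewrite mem_subgroupoid_idents // => /andP[-> /eqP]. Qed.

Lemma gdom_idents A g : g \in A -> gdom g \in idents A.
Proof. by move=> gA; rewrite !inE imset_f. Qed.

Lemma grng_idents A g : g \in A -> grng g \in idents A.
Proof. by move=> gA; rewrite !inE orbC imset_f. Qed.

Lemma identsS A B : A \subset B -> idents A \subset idents B.
Proof. by move=> sAB; rewrite setUSS ?imsetS. Qed.

Lemma idents_setI A B : subgroupoid A -> subgroupoid B ->
  idents (A :&: B) = idents A :&: idents B.
Proof.
move=> sA sB; apply/setP=> x; rewrite mem_idents => [|g|g]; last first.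
- by rewrite !inE => /andP[gA gB]; rewrite !subgroupoid_grng.
- by rewrite !inE => /andP[gA gB]; rewrite !subgroupoid_gdom.
by rewrite !in_setI !mem_subgroupoid_idents // andbACA andbb.
Qed.

(** * The order of a connected groupoid *)

Definition hom_set A x y : {set G} :=
  [set g in A | (gdom g == x) && (grng g == y)].

Lemma hom_setP A x y g :
  reflect [/\ g \in A, gdom g = x & grng g = y] (g \in hom_set A x y).
Proof.
by rewrite inE; apply: (iffP and3P) => [[? /eqP ? /eqP]|[? -> ->]].
Qed.

(** Translating by [b] on the left and by [a] on the right is injective. *)
Lemma leq_card_hom_set A x y x' y' : subgroupoid A ->
    (exists2 a, a \in A & gdom a = x' /\ grng a = x) ->
    (exists2 b, b \in A & gdom b = y /\ grng b = y') ->
  #|hom_set A x y| <= #|hom_set A x' y'|.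
Proof.
move=> sA [a aA [Da Ra]] [b bA [Db Rb]].
pose tr g := gmul b (gmul g a).
have inj_tr : {in hom_set A x y &, injective tr}.
  apply: (@can_in_inj _ _ _ _ (fun u => gmul (gmul (ginv b) u) (ginv a))).
  move=> g /hom_setP[gA Dg Rg]; rewrite /tr gmulKg ?gmulK ?grngM ?Dg ?Db //.
rewrite -(card_in_imset inj_tr); apply/subset_leq_card/subsetP=> u.
case/imsetP=> g /hom_setP[gA Dg Rg] ->; have Ega : gdom g = grng a by rewrite Dg.
apply/hom_setP; split; rewrite /tr.
- by rewrite !subgroupoid_gmul ?grngM // Db.
- by rewrite !gdomM ?grngM // Db.
by rewrite !grngM // Db.
Qed.

Lemma card_hom_set A x y x' y' : subgroupoid A -> gconnected A ->
    x \in idents A -> y \in idents A -> x' \in idents A -> y' \in idents A ->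
  #|hom_set A x y| = #|hom_set A x' y'|.
Proof.
by move=> sA cA *; apply/eqP; rewrite eqn_leq !leq_card_hom_set //; apply: cA.
Qed.

(** Sorting the elements by domain and range splits [A] into as many
    equinumerous sets as there are pairs of identities. *)
Lemma card_gconnected A x : subgroupoid A -> gconnected A -> x \in idents A ->
  #|A| = #|idents A| ^ 2 * #|isotropy A x|.
Proof.
move=> sA cA xA; rewrite -sum1_card.
rewrite (partition_big (@gdom G) (mem (idents A))) => [|g]; last exact: gdom_idents.
rewrite -mulnn -mulnA -sum_nat_const; apply: eq_bigr => y yA.
rewrite (partition_big (@grng G) (mem (idents A))) => [|g /andP[]]; last first.
  by move=> gA _; apply: grng_idents.
rewrite -sum_nat_const; apply: eq_bigr => z zA.
rewrite -[#|isotropy A x|](@card_hom_set A y z) // -sum1_card.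
by apply: eq_bigl => g; rewrite inE andbA.
Qed.

(** * Lagrange's theorem for isotropy groups *)

(** The fibres of the map sending [g] to its left coset by [isotropy A x] are
    the cosets themselves, and left translation by [g] makes each of them as
    large as [isotropy A x]. *)
Lemma dvdn_isotropy A B x : subgroupoid A -> subgroupoid B -> A \subset B ->
  x \in idents A -> #|isotropy A x| %| #|isotropy B x|.
Proof.
move=> sA sB /subsetP sAB xA.
pose c g := [set gmul g h | h in hom_set A x x].
rewrite -[#|isotropy B x|]sum1_card (partition_big_imset c) /=.
apply: dvdn_sum => _ /imsetP[g /hom_setP[gB Dg Rg] ->].
have cP u : u \in hom_set B x x -> c u = c g -> u \in c g.
  move=> /hom_setP[uB Du Ru] <-; have [Ax Dx] := identsP sA xA.
  apply/imsetP; exists x; last by rewrite -[x in gmul u x]Du gmul_gdom.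
  by apply/hom_setP; split=> //; apply: grng_ident.
have Pc h : h \in hom_set A x x ->
    gmul g h \in hom_set B x x /\ c (gmul g h) = c g.
  case/hom_setP=> hA Dh Rh; have Egh : gdom g = grng h by rewrite Dg.
  split.
    apply/hom_setP; rewrite gdomM ?grngM //; split=> //.
    by rewrite subgroupoid_gmul // sAB.
  apply/setP=> v; apply/imsetP/imsetP=> -[k /hom_setP[kA Dk Rk] ->].
    exists (gmul h k); last by rewrite gmulA // Rk.
    apply/hom_setP; rewrite gdomM ?grngM ?Dh //; split=> //.
    by rewrite subgroupoid_gmul // Dh.
  exists (gmul (ginv h) k); last first.
    by rewrite -gmulA ?grngM ?gmulKVg ?gdomV ?grngV ?Rh //.
  apply/hom_setP; rewrite gdomM ?grngM ?gdomV ?grngV ?Rh //; split=> //.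
  by rewrite subgroupoid_gmul ?subgroupoid_ginv ?gdomV ?Rh.
have -> : \sum_(u in isotropy B x | c u == c g) 1 = #|c g|.
  rewrite -sum1_card; apply: eq_bigl => u.
  apply/andP/idP=> [[uB /eqP /cP]|/imsetP[h /Pc[hB ch] ->]]; first exact.
  by rewrite ch.
rewrite card_in_imset //; apply: (@can_in_inj _ _ _ _ (gmul (ginv g))).
by move=> h /hom_setP[_ _ Rh]; rewrite gmulKg // Rh.
Qed.

(** * Components *)

(** An explicit form of the component of [A] at an identity [x], from which
    components are seen to exist and to be determined by any one of their
    identities. Reaching the domain of [g] from [x] is enough, since [g] itself
    then leads on to its range. *)
Definition hull A x : {set G} :=
  [set g in A | [exists a in A, (gdom a == x) && (grng a == gdom g)]].

Lemma hullP A x g :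
  reflect (g \in A /\ exists2 a, a \in A & gdom a = x /\ grng a = gdom g)
          (g \in hull A x).
Proof.
rewrite inE; apply: (iffP andP) => -[gA].
  by case/exists_inP=> a aA /andP[/eqP Da /eqP Ra]; split=> //; exists a.
by case=> a aA [Da Ra]; split=> //; apply/exists_inP; exists a; rewrite ?Da ?Ra ?eqxx.
Qed.

Lemma hull_sub A x : hull A x \subset A.
Proof. by apply/subsetP=> g /hullP[]. Qed.

Lemma mem_hull A x : subgroupoid A -> x \in idents A -> x \in hull A x.
Proof.
move=> sA /(identsP sA)[xA Dx]; apply/hullP; split=> //.
by exists x => //; rewrite (grng_ident Dx) Dx.
Qed.

Lemma subgroupoid_hull A x :
  subgroupoid A -> x \in idents A -> subgroupoid (hull A x).
Proof.
move=> sA xA; apply/subgroupoidP; split=> [|g h u|g].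
- by apply/set0Pn; exists x; apply: mem_hull.
- move=> /hullP[gA _] /hullP[hA [a aA [Da Ra]]] E.
  have Egh := gop_composable E; rewrite -(gop_gmul E).
  by apply/hullP; rewrite subgroupoid_gmul // gdomM //; split=> //; exists a.
move=> /hullP[gA [a aA [Da Ra]]]; apply/hullP; rewrite subgroupoid_ginv //.
split=> //; exists (gmul g a); first exact: subgroupoid_gmul.
by rewrite gdomM ?grngM ?gdomV.
Qed.

Lemma gconnected_hull A x :
  subgroupoid A -> x \in idents A -> gconnected (hull A x).
Proof.
move=> sA xA y z.
have sK := subgroupoid_hull sA xA.
case/(identsP sK)=> /hullP[yA [a aA [Da Ra]]] Dy.
case/(identsP sK)=> /hullP[zA [b bA [Db Rb]]] Dz.
have Eba : gdom b = grng (ginv a) by rewrite grngV Da.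
have D : gdom (gmul b (ginv a)) = y by rewrite gdomM // gdomV Ra.
exists (gmul b (ginv a)); last by rewrite D grngM // Rb.
apply/hullP; rewrite subgroupoid_gmul ?subgroupoid_ginv //; split=> //.
by exists a => //; rewrite D Ra.
Qed.

(** With [subgroupoid_hull] and [gconnected_hull], this makes the hull the
    largest connected subgroupoid of [A] having [x] as an identity. *)
Lemma sub_hull A D x : subgroupoid D -> D \subset A -> gconnected D ->
  x \in idents D -> D \subset hull A x.
Proof.
move=> sD /subsetP sDA cD xD; apply/subsetP=> g gD.
have [a aD Ea] := cD x (gdom g) xD (gdom_idents gD).
by apply/hullP; split; [apply: sDA | exists a => //; apply: sDA].
Qed.

Lemma component_hull A x :
  subgroupoid A -> x \in idents A -> component A (hull A x).
Proof.
move=> sA xA; have sK := subgroupoid_hull sA xA.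
split; [exact: sK | exact: hull_sub | exact: gconnected_hull |].
move=> D sD sDA cD sKD; apply/eqP; rewrite eqEsubset sKD andbT.
apply: sub_hull => //; apply: subsetP (identsS sKD) _ _.
by rewrite mem_subgroupoid_idents // mem_hull //= (identsP sA xA).2.
Qed.

Lemma component_eq_hull A C x :
  subgroupoid A -> component A C -> x \in idents C -> C = hull A x.
Proof.
move=> sA [sC sCA cC mC] xC; have xA := subsetP (identsS sCA) x xC.
apply/esym/mC; [exact: subgroupoid_hull | exact: hull_sub | | exact: sub_hull].
exact: gconnected_hull.
Qed.

Lemma gconnected_sub_component A C D x : subgroupoid A -> component A C ->
    subgroupoid D -> D \subset A -> gconnected D ->
  x \in idents C -> x \in idents D -> D \subset C.
Proof.
by move=> sA hC sD sDA cD /(component_eq_hull sA hC) ->; apply: sub_hull.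
Qed.

(** The component in question is the hull of the domain of [g]: any component
    containing [g] has this domain among its identities. *)
Lemma mem_components A n (F : 'I_n -> {set G}) g : subgroupoid A ->
  components_of A F -> g \in A -> exists i, forall j, (g \in F j) = (j == i).
Proof.
move=> sA [injF FP] gA; have xA := gdom_idents gA.
have [i Fi] := (FP _).1 (component_hull sA xA).
exists i => j; apply/idP/eqP=> [gFj|->].
  apply: injF; rewrite Fi; apply: component_eq_hull => //.
    by apply/FP; exists j.
  exact: gdom_idents.
rewrite Fi; apply/hullP; split=> //; exists (gdom g).
  exact: subgroupoid_gdom.
by rewrite gdom_gdom grng_gdom.
Qed.

(** The subset [S] is left free because sets of identities, and not only [A],
    have to be counted along the components. *)
Lemma sum_card_components A n (F : 'I_n -> {set G}) (S : {set G}) :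
    subgroupoid A -> components_of A F -> S \subset A ->
  \sum_(i < n) #|S :&: F i| = #|S|.
Proof.
move=> sA cF /subsetP sSA.
transitivity (\sum_(i < n) \sum_(g in S) (g \in F i)).
  apply: eq_bigr => i _; rewrite -big_mkcondr -sum1_card.
  by apply: eq_bigl => g; rewrite inE.
rewrite exchange_big -sum1_card; apply: eq_bigr => g /sSA gA /=.
have [i Fi] := mem_components sA cF gA.
by rewrite (bigD1 i) //= Fi eqxx big1 // => j /negbTE Nij; rewrite Fi Nij.
Qed.

Lemma idents_component A C : subgroupoid A -> component A C ->
  idents C = idents A :&: C.
Proof.
move=> sA [sC /subsetP sCA _ _]; apply/setP=> x.
rewrite in_setI !mem_subgroupoid_idents //.
by case xC: (x \in C); rewrite ?andbF ?andbT // sCA.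
Qed.

Lemma sum_card_idents_components A n (F : 'I_n -> {set G}) :
  subgroupoid A -> components_of A F ->
  \sum_(i < n) #|idents (F i)| = #|idents A|.
Proof.
move=> sA cF; rewrite -(sum_card_components sA cF).
  apply: eq_bigr => i _; rewrite (idents_component sA) //.
  by apply/cF.2; exists i.
by apply/subsetP=> x /(identsP sA)[].
Qed.

Lemma card_components A n (F : 'I_n -> {set G}) (x : 'I_n -> G) :
    subgroupoid A -> components_of A F -> (forall i, x i \in idents (F i)) ->
  #|A| = \sum_(i < n) #|idents (F i)| ^ 2 * #|isotropy (F i) (x i)|.
Proof.
move=> sA cF hx; rewrite -(sum_card_components sA cF (subxx A)).
apply: eq_bigr => i _; have [sF sFA kF _] : component A (F i).
  by apply/cF.2; exists i.
by rewrite (setIidPr sFA) (@card_gconnected _ (x i)).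
Qed.

(** * Comparison of two subgroupoids *)

(** The connected [C] only serves to join [x] to [y]; the isotropy groups are
    those of the larger [A], which may be disconnected. *)
Lemma card_isotropy_connected A C x y : subgroupoid A -> subgroupoid C ->
    C \subset A -> gconnected C -> x \in idents C -> y \in idents C ->
  #|isotropy A x| = #|isotropy A y|.
Proof.
move=> sA sC /subsetP sCA cC xC yC.
have path u v : u \in idents C -> v \in idents C ->
    exists2 a, a \in A & gdom a = u /\ grng a = v.
  by move=> uC vC; have [a /sCA] := cC u v uC vC; exists a.
by apply/eqP; rewrite eqn_leq !(@leq_card_hom_set A) //; apply: path.
Qed.

Lemma dvdn_gconnected A B : subgroupoid A -> subgroupoid B -> A \subset B ->
    gconnected A -> gconnected B ->
  #|idents A| %| #|idents B| -> #|A| %| #|B|.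
Proof.
move=> sA sB sAB cA cB dvdAB; have [g gA] := subgroupoid_nonempty sA.
have xA := gdom_idents gA; have xB := subsetP (identsS sAB) _ xA.
rewrite (card_gconnected sA cA xA) (card_gconnected sB cB xB).
by rewrite dvdn_mul ?dvdn_exp2r ?dvdn_isotropy.
Qed.

End Groupoid.

(** * The theorem *)

Import GRing.Theory Num.Theory.

Theorem theorem4p8 (G : finGroupoid) (t : nat) (Gc : 'I_t -> {set G})
    (hGc : components_of [set: G] Gc)
    (e : 'I_t -> G) (he : forall j, e j \in idents (Gc j))
    (H : {set G}) (hH : subgroupoid H) :
  [/\ (* (i) *)
      forall (l : nat) (Hc : 'I_l -> {set G}), components_of H Hc ->
        exists d m : 'I_l -> nat,
          [/\ #|H| = \sum_(j < l) d j ^ 2 * m j,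
              \sum_(j < l) d j <= #|idents [set: G]|
            & forall j : 'I_l, exists2 s : 'I_t,
                Hc j \subset Gc s & m j %| #|isotropy [set: G] (e s)|],
      (* (ii) *)
      gconnected [set: G] -> gconnected H ->
        #|idents H| %| #|idents [set: G]| -> #|H| %| #|[set: G]|
    & (* (iii) *)
      wide H ->
      forall (n : nat) (K : 'I_n -> {set G}), components_of H K ->
      forall f : 'I_n -> G, (forall i, f i \in idents (K i)) ->
        (#|[set: G]|%:R : rat)%R =
        (\sum_(j < t) #|idents (Gc j)|%:R *
           (\sum_(i < n)
              index_ratio (isotropy (Gc j) (e j)) (isotropy (K i) (f i)) *
              #|idents ((Gc j :&: H) :&: K i)|%:R *
              #|isotropy (K i) (f i)|%:R))%R ].
Proof.
have sG := subgroupoidT G.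
have compG j : component [set: G] (Gc j) by apply/hGc.2; exists j.
split.
- move=> l Hc cHc.
  have compH i : component H (Hc i) by apply/cHc.2; exists i.
  have [x hx] : exists x : 'I_l -> G, forall i, x i \in idents (Hc i).
    apply: (@fin_all_exists _ (fun=> G) (fun i y => y \in idents (Hc i))) => i.
    have [sHi _ _ _] := compH i.
    have [g gHi] := subgroupoid_nonempty sHi.
    by exists (gdom g); apply: gdom_idents.
  exists (fun i => #|idents (Hc i)|), (fun i => #|isotropy (Hc i) (x i)|).
  split=> [||i]; first exact: card_components.
    by rewrite (sum_card_idents_components hH cHc) subset_leq_card ?identsS ?subsetT.
  have [sHi sHiH cHi _] := compH i; have [xHi Dx] := identsP sHi (hx i).
  have [s Es] := mem_components sG hGc (in_setT (x i)).
  have [sGs sGsG cGs _] := compG s.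
  have xGs : x i \in idents (Gc s).
    by rewrite mem_subgroupoid_idents // Es eqxx Dx eqxx.
  exists s.
    by apply: (@gconnected_sub_component _ _ _ _ (x i) sG) => //; apply: subsetT.
  rewrite (@card_isotropy_connected _ _ _ _ (x i) sG sGs sGsG cGs) //.
  by rewrite dvdn_isotropy ?subsetT.
- by move=> cG cH; apply: dvdn_gconnected; rewrite ?subsetT.
move=> wH n K cK f hf.
rewrite (card_components sG hGc he) natr_sum.
apply: eq_bigr => j _; have [sGj _ _ _] := compG j.
rewrite natrM expnS expn1 natrM -mulrA; congr (_ * _)%R.
have sGjI : idents (Gc j) \subset idents H by rewrite wH identsS ?subsetT.
have sGjH : idents (Gc j) \subset H.
  by apply: subset_trans sGjI _; apply/subsetP=> x /(identsP hH)[].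
rewrite -{1}(sum_card_components hH cK sGjH) natr_sum mulr_suml.
apply: eq_bigr => i _; have compK : component H (K i) by apply/cK.2; exists i.
have [sKi sKiH _ _] := compK; have [fKi Df] := identsP sKi (hf i).
have K0 : (#|isotropy (K i) (f i)|%:R : rat)%R != 0%R.
  rewrite pnatr_eq0 -lt0n; apply/card_gt0P; exists (f i).
  by rewrite inE fKi Df (grng_ident Df) eqxx.
(* In this form the identities of [Gc j] are counted along the components of
   [H]; by wideness they are all identities of [H]. *)
have -> : idents (Gc j :&: H :&: K i) = idents (Gc j) :&: K i.
  rewrite -setIA (setIidPr sKiH) idents_setI // (idents_component hH compK).
  by rewrite setIA (setIidPl sGjI).
by rewrite /index_ratio mulrAC divfK // mulrC.
Qed.
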